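(* Let $F$ be a face of the derived arrangement $\delta\mathcal{A}_{\bm o}$ and let $\bm a,\bm b\in\operatorname{relint}(F)$. Then for every partition $I,J,K$ of $[m]$, the polyhedra $P(\bm a,I,J,K)$ and $P(\bm b,I,J,K)$ are either both empty or both nonempty, and in the latter case they are normally equivalent and combinatorially equivalent.
   Context: Fix nonzero vectors $\bm u_1,\dots,\bm u_m\in\mathbb{R}^n$ (repetitions and parallel vectors allowed) and let $U$ be the $m\times n$ matrix with rows $\bm u_1,\dots,\bm u_m$. For $I\subseteq[m]=\{1,\dots,m\}$, $U_I$ is the submatrix of rows indexed by $I$, and for $\bm a\in\mathbb{R}^m$, $\bm a_I$ is the subvector with indices in $I$. For $\bm a\in\mathbb{R}^m$ and a partition $I,J,K$ of $[m]$ (parts may be empty), $P(\bm a,I,J,K)=\{\bm x\in\mathbb{R}^n: U_I\bm x=\bm a_I,\ U_J\bm x\le \bm a_J,\ U_K\bm x\ge\bm a_K\}$ (componentwise inequalities). Derived arrangement: a circuit is a subset $C\subseteq[m]$ such that the indexed family $\{\bm u_i: i\in C\}$ is a minimal linearly dependent family. For each circuit $C$ fix a circuit vector $\bm c^C=(c_1,\dots,c_m)\in\mathbb{R}^m$ with $\sum_i c_i\bm u_i=\bm 0$ and $c_i\ne0\iff i\in C$ (unique up to a nonzero scalar). The derived arrangement $\delta\mathcal{A}_{\bm o}$ is the arrangement in $\mathbb{R}^m$ of the linear hyperplanes $\{\bm y\in\mathbb{R}^m:\langle \bm c^C,\bm y\rangle=0\}$, $C$ ranging over all circuits. Its open faces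 are the nonempty sets of the form $\{\bm y: \operatorname{sign}\langle\bm c^C,\bm y\rangle=\epsilon_C\text{ for all circuits }C\}$ for fixed $\epsilon_C\in\{+,0,-\}$; its faces are the closures of the open faces, and $\operatorname{relint}(F)$ is the open face whose closure is $F$. For a nonempty convex polyhedron $P\subseteq\mathbb{R}^n$, its support function is $h_P(\bm u)=\sup\{\langle\bm u,\bm x\rangle:\bm x\in P\}$; for $\bm x\in P$ the normal cone is $N_P(\bm x)=\{\bm u\in\mathbb{R}^n:\langle\bm u,\bm x\rangle=h_P(\bm u)\}$; for a nonempty face $G$ of $P$, $N_P(G)=N_P(\bm x)$ for any $\bm x\in\operatorname{relint}(G)$; the normal fan is $\mathcal{N}(P)=\{N_P(G): G \text{ a nonempty face of }P\}$. Two convex polyhedra are normally equivalent if they have the same normal fan, and combinatorially equivalent if their face posets (all faces including $\emptyset$ and the polyhedron itself, ordered by inclusion) are isomorphic. *)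

(* Defs.v *)
From HB Require Import structures.
From mathcomp Require Import all_boot all_order all_algebra.
From mathcomp Require Import boolp classical_sets reals.
Set Implicit Arguments. Unset Strict Implicit. Unset Printing Implicit Defensive.
Import Order.TTheory GRing.Theory Num.Theory.
Local Open Scope ring_scope.
Local Open Scope classical_set_scope.

Section Defs.
Variables (R : realType) (m n : nat).

Definition dotv k (u x : 'cV[R]_k) : R := \sum_(j < k) u j 0 * x j 0.

Definition lin_dep (U : 'M[R]_(m, n)) (C : {set 'I_m}) : Prop :=
  exists c : 'I_m -> R,
    (forall i, i \notin C -> c i = 0) /\ (exists i, c i != 0) /\
    \sum_(i < m) c i *: row i U = 0.

Definition circuit (U : 'M[R]_(m, n)) (C : {set 'I_m}) : Prop :=
  lin_dep U C /\ forall D : {set 'I_m}, D \proper C -> ~ lin_dep U D.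

Definition circuit_vector (U : 'M[R]_(m, n)) (C : {set 'I_m}) (c : 'cV[R]_m) : Prop :=
  \sum_(i < m) c i 0 *: row i U = 0 /\ forall i, c i 0 != 0 <-> i \in C.

Definition derived_open_face (U : 'M[R]_(m, n)) (cv : {set 'I_m} -> 'cV[R]_m)
  (Fo : set 'cV[R]_m) : Prop :=
  (exists y, Fo y) /\
  exists eps : {set 'I_m} -> R,
    (forall C, eps C \in [:: 1; 0; -1]) /\
    Fo = [set y | forall C, circuit U C -> Num.sg (dotv (cv C) y) = eps C].

Definition partition3 (I J K : {set 'I_m}) : Prop :=
  forall i : 'I_m, [|| i \in I, i \in J | i \in K] /\
    ~~ ((i \in I) && (i \in J)) /\ ~~ ((i \in I) && (i \in K)) /\
    ~~ ((i \in J) && (i \in K)).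

Definition Pol (U : 'M[R]_(m, n)) (a : 'cV[R]_m) (I J K : {set 'I_m}) : set 'cV[R]_n :=
  [set x | forall i : 'I_m,
     (i \in I -> (U *m x) i 0 = a i 0) /\
     (i \in J -> (U *m x) i 0 <= a i 0) /\
     (i \in K -> (U *m x) i 0 >= a i 0)].

(** Faces of a convex polyhedron P (including the empty face and P itself):
    intersections of P with a valid inequality <u,x> <= h taken with equality. *)
Definition poly_face (P G : set 'cV[R]_n) : Prop :=
  exists (u : 'cV[R]_n) (h : R),
    (forall y, P y -> dotv u y <= h) /\ G = [set x | P x /\ dotv u x = h].

Definition aff_hull (G : set 'cV[R]_n) : set 'cV[R]_n :=
  [set y | exists (k : nat) (p : 'I_k -> 'cV[R]_n) (w : 'I_k -> R),
      (forall i, G (p i)) /\ \sum_(i < k) w i = 1 /\ y = \sum_(i < k) w i *: p i].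

Definition relint (G : set 'cV[R]_n) : set 'cV[R]_n :=
  [set x | G x /\ exists eps : R, 0 < eps /\
      forall y, aff_hull G y -> (forall j, `|y j 0 - x j 0| < eps) -> G y].

(** Normal cone at x in P: {u | <u,x> = h_P(u)}; since x \in P this says that
    <u,x> is the supremum of <u,.> over P, i.e. <u,y> <= <u,x> for all y in P. *)
Definition normal_cone (P : set 'cV[R]_n) (x : 'cV[R]_n) : set 'cV[R]_n :=
  [set u | forall y, P y -> dotv u y <= dotv u x].

(** Normal cone of a face G: N_P(x) for x in relint G
    (well defined, as N_P(x) does not depend on the choice of x in relint G). *)
Definition normal_cone_face (P G : set 'cV[R]_n) : set 'cV[R]_n :=
  [set u | exists x, relint G x /\ normal_cone P x u].

Definition normal_fan (P : set 'cV[R]_n) : set (set 'cV[R]_n) :=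
  [set N | exists G, poly_face P G /\ (exists x, G x) /\ N = normal_cone_face P G].

Definition normally_equivalent (P Q : set 'cV[R]_n) : Prop :=
  normal_fan P = normal_fan Q.

Definition combinatorially_equivalent (P Q : set 'cV[R]_n) : Prop :=
  exists f : set 'cV[R]_n -> set 'cV[R]_n,
    (forall G, poly_face P G -> poly_face Q (f G)) /\
    (forall G1 G2, poly_face P G1 -> poly_face P G2 -> f G1 = f G2 -> G1 = G2) /\
    (forall H, poly_face Q H -> exists G, poly_face P G /\ f G = H) /\
    (forall G1 G2, poly_face P G1 -> poly_face P G2 ->
       (G1 `<=` G2 <-> f G1 `<=` f G2)).

End Defs.

(* Main.v *)
(* Write [P(a)] for [Pol U a I J K].  The faces of [P(a)] and its normal cones are determined
   by which sets of constraints are active at its points: [N_P(x)] is the polar of the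
   tangent cone at [x], which only depends on the constraints active at [x], and a nonempty
   face is the set of points of [P(a)] at which all constraints active at some given point
   remain active.  So it suffices to match each point [x] of [P(a)] with a point [y] of
   [P(b)] such that [U x - a] and [U y - b] have the same signs.  By Fourier-Motzkin
   elimination, if no such [y] existed, a linear dependency of the rows of [U] would
   certify this.  A dependency is a sum of circuit vectors with compatible signs, and on
   circuit vectors the pairings with [a] and [b] have the same sign, so no [x] could exist
   for [a] either. *)
Require Import Defs.
From HB Require Import structures.
From mathcomp Require Import all_boot all_order all_algebra.
From mathcomp Require Import boolp classical_sets reals.
From mathcomp Require Import ring lra.
Set Implicit Arguments. Unset Strict Implicit. Unset Printing Implicit Defensive.
Import Order.TTheory GRing.Theory Num.Theory.
Local Open Scope ring_scope.
Local Open Scope classical_set_scope.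

(** * Bilinearity of the dot product *)

Section DotProduct.
Context {R : realType} {k : nat}.
Implicit Types (u v x y : 'cV[R]_k) (c : R).

Lemma dotvDl u v x : dotv (u + v) x = dotv u x + dotv v x.
Proof. by rewrite /dotv -big_split /=; apply: eq_bigr => j _; rewrite mxE mulrDl. Qed.

Lemma dotvZl c u x : dotv (c *: u) x = c * dotv u x.
Proof. by rewrite /dotv mulr_sumr; apply: eq_bigr => j _; rewrite mxE mulrA. Qed.

Lemma dotvC u x : dotv u x = dotv x u.
Proof. by apply: eq_bigr => j _; rewrite mulrC. Qed.

Lemma dotvDr u x y : dotv u (x + y) = dotv u x + dotv u y.
Proof. by rewrite ![dotv u _]dotvC dotvDl. Qed.

Lemma dotvZr c u x : dotv u (c *: x) = c * dotv u x.
Proof. by rewrite ![dotv u _]dotvC dotvZl. Qed.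

Lemma dotv0l x : dotv 0 x = 0.
Proof. by rewrite -[0 in LHS](scale0r x) dotvZl mul0r. Qed.

Lemma dotvNl u x : dotv (- u) x = - dotv u x.
Proof. by rewrite -scaleN1r dotvZl mulN1r. Qed.

Lemma dotvNr u x : dotv u (- x) = - dotv u x.
Proof. by rewrite ![dotv u _]dotvC dotvNl. Qed.

Lemma dotvBr u x y : dotv u (x - y) = dotv u x - dotv u y.
Proof. by rewrite dotvDr dotvNr. Qed.

Lemma dotv_suml (T : finType) (P : pred T) (u : T -> 'cV[R]_k) x :
  dotv (\sum_(i | P i) u i) x = \sum_(i | P i) dotv (u i) x.
Proof.
apply: (big_ind2 (fun v r => dotv v x = r)) => [|? ? ? ? <- <-|//].
  exact: dotv0l.
exact: dotvDl.
Qed.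

Lemma dotv_delta u (j : 'I_k) : dotv u (delta_mx j 0) = u j 0.
Proof.
rewrite /dotv (bigD1 j) //= big1 ?addr0 => [|i ij]; first by rewrite mxE !eqxx mulr1.
by rewrite mxE (negbTE ij) mulr0.
Qed.

End DotProduct.

(** * Fourier-Motzkin elimination for mixed strict and weak inequalities *)

Section FourierMotzkin.
Context {R : realType}.

Definition holds (strict : bool) (y : R) : bool := if strict then 0 < y else 0 <= y.

Lemma holds_pmul s (c y : R) : 0 < c -> holds s (c * y) = holds s y.
Proof. by move=> c0; case: s; rewrite /= ?pmulr_rgt0 ?pmulr_rge0. Qed.

(** Solved for [t], the inequality [i] is a lower bound [r i] when [c i > 0] and an upper bound
    [r i] when [c i < 0], where [r i = - y i / c i]. The second hypothesis puts every lower bound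
    below every upper bound, so [t] fits between the largest lower and the smallest upper one. *)
Lemma exists_between (T : finType) (c y : T -> R) (s : T -> bool) :
  (forall i, c i = 0 -> holds (s i) (y i)) ->
  (forall p q, 0 < c p -> c q < 0 -> holds (s p || s q) (c p * y q - c q * y p)) ->
  exists t, forall i, holds (s i) (y i + t * c i).
Proof.
move=> h0 hpq; pose r i := - y i / c i.
have yE i : c i != 0 -> y i = - (c i * r i) by move=> ci; rewrite /r; field.
suff [t ht] : exists t, (forall p, 0 < c p -> holds (s p) (t - r p)) /\
                        (forall q, c q < 0 -> holds (s q) (r q - t)).
  exists t => i; case: (ltgtP (c i) 0) => ci; last by rewrite ci mulr0 addr0 h0.
    rewrite (yE i (ltr0_neq0 ci)).
    have -> : - (c i * r i) + t * c i = (- c i) * (r i - t) by ring.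
    by rewrite holds_pmul ?oppr_gt0 //; apply: ht.2.
  rewrite (yE i (lt0r_neq0 ci)).
  have -> : - (c i * r i) + t * c i = c i * (t - r i) by ring.
  by rewrite holds_pmul //; apply: ht.1.
have {}hpq p q : 0 < c p -> c q < 0 -> holds (s p || s q) (r q - r p).
  move=> cp cq; have := hpq p q cp cq.
  rewrite (yE p (lt0r_neq0 cp)) (yE q (ltr0_neq0 cq)).
  have -> : c p * - (c q * r q) - c q * - (c p * r p) = (c p * - c q) * (r q - r p).
    by ring.
  by rewrite holds_pmul // mulr_gt0 // oppr_gt0.
have maxP : (forall p, ~~ (0 < c p)) \/
    exists2 p0, 0 < c p0 & forall p, 0 < c p -> r p <= r p0.
  case: (pickP [pred p | 0 < c p]) => [p /= cp|no]; last by left=> p; have /= -> := no p.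
  by right; case: (Order.TotalTheory.arg_maxP (P := fun i => 0 < c i) r cp)
    => p0 cp0 hp0; exists p0.
have minP : (forall q, ~~ (c q < 0)) \/
    exists2 q0, c q0 < 0 & forall q, c q < 0 -> r q0 <= r q.
  case: (pickP [pred q | c q < 0]) => [q /= cq|no]; last by left=> q; have /= -> := no q.
  by right; case: (Order.TotalTheory.arg_minP (P := fun i => c i < 0) r cq)
    => q0 cq0 hq0; exists q0.
case: maxP minP => [nop|[p0 cp0 hp0]] [noq|[q0 cq0 hq0]].
- by exists 0; split=> i ci; [case/negP: (nop i)|case/negP: (noq i)].
- exists (r q0 - 1); split=> i ci; first by case/negP: (nop i).
  by have := hq0 i ci; case: (s i) => /=; lra.
- exists (r p0 + 1); split=> i ci; last by case/negP: (noq i).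
  by have := hp0 i ci; case: (s i) => /=; lra.
(* The midpoint also meets strict bounds: a strict lower bound [r i] satisfies both [r i <= r p0]
   and [r i < r q0], and symmetrically for upper bounds. *)
- exists ((r p0 + r q0) / 2); split=> i ci.
    by have := hp0 i ci; have := hpq i q0 ci cq0; case: (s i) => /=; case: (s q0) => /=; lra.
  by have := hq0 i ci; have := hpq p0 i cp0 ci; case: (s i); case: (s p0) => /=; lra.
Qed.

Context {n : nat}.

(* [derived v beta s b w g]: the inequality [<w, x> + g >= 0] (strict if [b]) is a
   nonnegative combination of the inequalities [<v i, x> + beta i >= 0] (strict if [s i]). *)
Inductive derived (T : Type) (v : T -> 'cV[R]_n) (beta : T -> R) (s : T -> bool) :
  bool -> 'cV[R]_n -> R -> Prop :=
| derived_gen i : derived v beta s (s i) (v i) (beta i)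
| derived0 : derived v beta s false 0 0
| derivedD b1 w1 g1 b2 w2 g2 :
    derived v beta s b1 w1 g1 -> derived v beta s b2 w2 g2 ->
    derived v beta s (b1 || b2) (w1 + w2) (g1 + g2)
| derivedZ c b w g :
    0 < c -> derived v beta s b w g -> derived v beta s b (c *: w) (c * g).

Lemma derived_trans (T T' : Type) (v : T -> 'cV[R]_n) beta s
    (v' : T' -> 'cV[R]_n) beta' s' b w g :
  (forall i, derived v beta s (s' i) (v' i) (beta' i)) ->
  derived v' beta' s' b w g -> derived v beta s b w g.
Proof.
move=> gen; elim=> [i||*|*]; [exact: gen|exact: derived0|exact: derivedD|exact: derivedZ].
Qed.

(** Induction on the number [k] of coordinates still present; each round eliminates the last of
    them. *)
Lemma fourier_motzkin_rec k (T : finType) (v : T -> 'cV[R]_n) beta (s : T -> bool) :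
  (forall i (j : 'I_n), (k <= j)%N -> v i j 0 = 0) ->
  (exists x, forall i, holds (s i) (dotv (v i) x + beta i)) \/
  (exists b g, derived v beta s b 0 g /\ ~~ holds b g).
Proof.
elim: k T v beta s => [|k IH] T v beta s hv.
  have v0 i : v i = 0 by apply/colP => j; rewrite mxE hv.
  have [allh|/existsNP[i /negP ni]] := pselect (forall i, holds (s i) (beta i)).
    by left; exists 0 => i; rewrite v0 dotv0l add0r.
  by right; exists (s i), (beta i); split => //; rewrite -(v0 i); apply: derived_gen.
case: (ltnP k n) => [kn|nk]; last first.
  by apply: IH => i j kj; have := leq_trans nk kj; rewrite leqNgt ltn_ord.
pose o := Ordinal kn; pose c i := v i o 0.
(* The new system is indexed by all pairs. An [opp] pair is combined so that coordinate [o] cancels,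
   a [zero] pair copies its first inequality, and any other pair yields the trivial [0 >= 0]. *)
pose opp (pq : T * T) := (0 < c pq.1) && (c pq.2 < 0).
pose zero (pq : T * T) := c pq.1 == 0.
pose v' (pq : T * T) := if opp pq then c pq.1 *: v pq.2 + (- c pq.2) *: v pq.1
                        else if zero pq then v pq.1 else 0.
pose beta' (pq : T * T) := if opp pq then c pq.1 * beta pq.2 + (- c pq.2) * beta pq.1
                           else if zero pq then beta pq.1 else 0.
pose s' (pq : T * T) := if opp pq then s pq.2 || s pq.1
                        else if zero pq then s pq.1 else false.
have der pq : derived v beta s (s' pq) (v' pq) (beta' pq).
  rewrite /s' /v' /beta'; case: ifPn => [/andP[cp cq]|_].
    by apply: derivedD; apply: derivedZ; rewrite ?oppr_gt0 //; apply: derived_gen.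
  by case: ifP => _; [apply: derived_gen|apply: derived0].
have hv' pq (j : 'I_n) : (k <= j)%N -> v' pq j 0 = 0.
  rewrite leq_eqVlt => /orP[/eqP kj|kj]; last first.
    rewrite /v'; case: ifP => _; first by rewrite !mxE !hv // !mulr0 addr0.
    by case: ifP => _; rewrite ?hv ?mxE.
  have -> : j = o by apply: val_inj.
  rewrite /v'; case: ifP => _; first by rewrite !mxE /c; ring.
  by case: ifP => [/eqP //|_]; rewrite mxE.
case: (IH _ v' beta' s' hv') => [[x hx]|[b [g [dg ng]]]]; last first.
  by right; exists b, g; split => //; apply: derived_trans dg.
left; case: (@exists_between T c (fun i => dotv (v i) x + beta i) s).
- move=> i ci; have := hx (i, i).
  by rewrite /s' /v' /beta' /opp /zero /= ci ltxx eqxx.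
- move=> p q cp cq; have := hx (p, q).
  rewrite /s' /v' /beta' /opp /= cp cq /= dotvDl !dotvZl orbC.
  by congr (holds _ _); ring.
move=> t ht; exists (x + t *: delta_mx o 0) => i.
by have := ht i; rewrite dotvDr dotvZr dotv_delta -/(c i); congr (holds _ _); ring.
Qed.

Lemma fourier_motzkin (T : finType) (v : T -> 'cV[R]_n) beta (s : T -> bool) :
  (exists x, forall i, holds (s i) (dotv (v i) x + beta i)) \/
  (exists b g, derived v beta s b 0 g /\ ~~ holds b g).
Proof.
by apply: (@fourier_motzkin_rec n) => i j; rewrite leqNgt ltn_ord.
Qed.

End FourierMotzkin.

(** * Conformal decomposition of dependencies into circuit vectors *)

Section Conformal.
Context {R : realType} {m : nat}.
Implicit Types c d e : 'cV[R]_m.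

Definition supp c : {set 'I_m} := [set i | c i 0 != 0]%SET.

(** In oriented matroid terms, the sign vector of [e] lies below that of [c]. *)
Definition conformal c e : Prop :=
  forall i, (c i 0 = 0 -> e i 0 = 0) /\ 0 <= c i 0 * e i 0.

Lemma conformal_refl c : conformal c c.
Proof. by move=> i; split=> //; rewrite -expr2 sqr_ge0. Qed.

Lemma conformal_trans c d e : conformal c d -> conformal d e -> conformal c e.
Proof.
move=> cd de i; have [cd0 cdi] := cd i; have [de0 dei] := de i; split.
  by move=> /cd0.
have [/de0 ->|di] := eqVneq (d i 0) 0; first by rewrite mulr0.
have : 0 < d i 0 ^+ 2 by rewrite exprn_even_gt0.
have : 0 <= (c i 0 * d i 0) * (d i 0 * e i 0) by rewrite mulr_ge0.
have -> : (c i 0 * d i 0) * (d i 0 * e i 0) = d i 0 ^+ 2 * (c i 0 * e i 0) by ring.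
by move=> h d2; rewrite pmulr_rge0 in h.
Qed.

Lemma conformal_scale c d (t : R) : 0 <= t -> conformal c d -> conformal c (t *: d).
Proof.
move=> t0 cd i; have [cd0 cdi] := cd i; rewrite mxE; split.
  by move=> /cd0 ->; rewrite mulr0.
by rewrite mulrCA mulr_ge0.
Qed.

(** Move from [c] along [- d] until a first coordinate vanishes: [t] is the least ratio [c i / d i]
    over the coordinates where the signs agree. Where they disagree, the entry of [c] only moves
    away from 0. *)
Lemma conformal_reduce c d i0 : supp d \subset supp c -> 0 < c i0 0 * d i0 0 ->
  exists t : R, [/\ 0 < t, conformal c (c - t *: d) & supp (c - t *: d) \proper supp c].
Proof.
move=> /fintype.subsetP dc hi0; pose f i := c i 0 / d i 0.
case: (Order.TotalTheory.arg_minP (P := fun i => 0 < c i 0 * d i 0) f hi0) => j hj hmin.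
have dn0 i : 0 < c i 0 * d i 0 -> d i 0 != 0.
  by move=> h; apply/eqP => d0; rewrite d0 mulr0 ltxx in h.
have fj : 0 < f j.
  have -> : f j = (c j 0 * d j 0) / d j 0 ^+ 2 by rewrite /f; field; rewrite dn0.
  by rewrite divr_gt0 // exprn_even_gt0 //= dn0.
have d0 i : c i 0 = 0 -> d i 0 = 0.
  by move=> ci; apply/eqP/negPn/negP => di; have := dc i; rewrite !inE ci eqxx di => /(_ isT).
have cf : conformal c (c - f j *: d).
  move=> i; rewrite !mxE; split; first by move=> ci; rewrite ci d0 // mulr0 subr0.
  have [h|h] := ltP 0 (c i 0 * d i 0).
    have -> : c i 0 * (c i 0 - f j * d i 0) = (c i 0 * d i 0) * (f i - f j).
      by rewrite /f; field; rewrite !dn0.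
    by rewrite mulr_ge0 ?subr_ge0 ?hmin // ltW.
  have -> : c i 0 * (c i 0 - f j * d i 0) = c i 0 ^+ 2 + f j * - (c i 0 * d i 0) by ring.
  by rewrite addr_ge0 ?sqr_ge0 // mulr_ge0 ?oppr_ge0 // ltW.
exists (f j); split=> //; apply/properP; split.
  apply/fintype.subsetP => i; rewrite !inE; apply: contraNN => /eqP ci.
  by rewrite (proj1 (cf i) ci).
exists j; rewrite !inE.
  by apply/eqP => cj; rewrite cj mul0r ltxx in hj.
by rewrite !mxE /f divfK ?subrr ?eqxx // dn0.
Qed.

Lemma col_neq0 c : c != 0 -> exists i, c i 0 != 0.
Proof.
move=> c0; apply/not_existsP => all0; case/eqP: c0; apply/colP => i; rewrite mxE.
by apply/eqP/negPn/negP; apply: all0.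
Qed.

Lemma supp0 c : supp c = finset.set0 -> c = 0.
Proof.
move=> h; apply/colP => i; rewrite mxE; apply/eqP/negPn.
by have := finset.in_set0 i; rewrite -h inE => ->.
Qed.

Context {n : nat}.
Variables (U : 'M[R]_(m, n)) (cv : {set 'I_m} -> 'cV[R]_m).

Definition dependency c : Prop := \sum_(i < m) c i 0 *: row i U = 0.

Lemma dependencyB c d (t : R) : dependency c -> dependency d -> dependency (c - t *: d).
Proof.
rewrite /dependency => hc hd.
transitivity ((\sum_(i < m) c i 0 *: row i U) - t *: \sum_(i < m) d i 0 *: row i U).
  rewrite scaler_sumr -sumrB; apply: eq_bigr => i _.
  by rewrite !mxE scalerBl scalerA.
by rewrite hc hd scaler0 subr0.
Qed.

Lemma dependencyN d : dependency d -> dependency (- d).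
Proof.
move=> hd; rewrite -[- d]addr0 addrC -[d]scale1r.
by apply: dependencyB => //; rewrite /dependency big1 // => i _; rewrite mxE scale0r.
Qed.

Lemma lin_depP (C : {set 'I_m}) :
  lin_dep U C <-> exists d, [/\ supp d \subset C, d != 0 & dependency d].
Proof.
split=> [[c [cC [[i ci] cU]]]|[d [/fintype.subsetP dC d0 dU]]].
  exists (\col_i c i); split.
  - apply/fintype.subsetP => j; rewrite !inE mxE; apply: contraR => jC.
    by rewrite cC.
  - by apply/eqP => /colP/(_ i); rewrite !mxE; apply/eqP.
  - by rewrite /dependency -[RHS]cU; apply: eq_bigr => j _; rewrite mxE.
exists (fun i => d i 0); split; last split=> //.
  move=> i iC; apply/eqP/negPn/negP => di.
  by case/negP: iC; apply: dC; rewrite inE.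
exact: col_neq0.
Qed.

(** Supplies the coordinate of common sign that [conformal_reduce] asks for, replacing [d] by [- d]
    if necessary. *)
Lemma exists_sign c d : d != 0 -> supp d \subset supp c -> dependency d ->
  exists e i, [/\ supp e = supp d, dependency e, (e = d \/ e = - d) & 0 < c i 0 * e i 0].
Proof.
move=> d0 dc dU.
have [i di] := col_neq0 d0.
have ci : c i 0 != 0 by have := fintype.subsetP dc i; rewrite !inE => /(_ di).
have : c i 0 * d i 0 != 0 by rewrite mulf_neq0.
rewrite neq_lt => /orP[h|h]; last by exists d, i; split=> //; left.
exists (- d), i; split; [|exact: dependencyN|by right|by rewrite mxE mulrN oppr_gt0].
by apply/finset.setP => j; rewrite !inE mxE oppr_eq0.
Qed.

Hypothesis cvP : forall C, circuit U C -> circuit_vector U C (cv C).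

(** Strong induction on the size of the support. On a circuit, minimality makes [c] a multiple of
    the circuit vector; otherwise [c] is reduced by a dependency of smaller support. *)
Lemma conformal_circuit c : c != 0 -> dependency c ->
  exists C (t : R), [/\ circuit U C, t *: cv C != 0 & conformal c (t *: cv C)].
Proof.
have [k] := ubnP #|supp c|; elim: k c => // k IH c /ltnSE ck c0 cU.
have dc : lin_dep U (supp c) by apply/lin_depP; exists c.
have [cC|ncC] := pselect (circuit U (supp c)).
  have [dU dC] := cvP cC; set d := cv (supp c) in dU dC.
  have sd : supp d = supp c.
    by apply/finset.setP => i; rewrite [in LHS]inE; apply/idP/idP => /dC.
  have d0 : d != 0.
    apply: contraNneq c0 => d0; apply/eqP/supp0; rewrite -sd d0.
    by apply/finset.setP => i; rewrite !inE mxE eqxx.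
  have [|e [i [se eU ed hi]]] := exists_sign (c := c) d0 _ dU; first by rewrite sd.
  have [|t [t0 cf sp]] := conformal_reduce (d := e) (c := c) (i0 := i) _ hi.
    by rewrite se sd.
  (* A nonzero remainder would be a dependency on a proper subset of the circuit. *)
  have [/eqP h|h] := boolP (c - t *: e == 0); last first.
    case: (cC.2 _ sp); apply/lin_depP; exists (c - t *: e); split=> //.
    exact: dependencyB.
  have ce : c = t *: e by apply/eqP; rewrite -subr_eq0 h.
  case: ed => edd; [exists (supp c), t|exists (supp c), (- t)]; split=> //.
  - by rewrite -/d -edd -ce.
  - by rewrite -/d -edd -ce; apply: conformal_refl.
  - by rewrite -/d scaleNr -scalerN -edd -ce.
  - by rewrite -/d scaleNr -scalerN -edd -ce; apply: conformal_refl.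
have [D [Dp /lin_depP[d [dD d0 dU]]]] : exists D : {set 'I_m}, D \proper supp c /\ lin_dep U D.
  apply/not_existsP => h; apply: ncC; split=> // D Dp Dd; exact: (h D).
have sdc : supp d \proper supp c by apply: sub_proper_trans Dp.
have [|e [i [se eU ed hi]]] := exists_sign (c := c) d0 _ dU; first exact: proper_sub.
have [|t [t0 cf sp]] := conformal_reduce (d := e) (c := c) (i0 := i) _ hi.
  by rewrite se proper_sub.
case: (IH (c - t *: e)).
- exact: leq_trans (proper_card sp) ck.
(* The remainder is nonzero: it agrees with [c] at a coordinate of [supp c] outside [supp d]. *)
- case/properP: sdc => _ [j jc]; rewrite -se inE negbK => /eqP ej.
  by apply/eqP => /colP/(_ j); rewrite !mxE ej mulr0 subr0; apply/eqP; rewrite inE in jc.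
- exact: dependencyB.
move=> C [r [Cc r0 cr]]; exists C, r; split=> //; exact: conformal_trans cr.
Qed.

(* The conformal decomposition of a dependency into circuit vectors, as an induction principle. *)
Lemma conformal_ind (Q : 'cV[R]_m -> Prop) c :
  Q 0 -> (forall d e, Q d -> Q e -> Q (d + e)) ->
  (forall C (t : R), circuit U C -> conformal c (t *: cv C) -> Q (t *: cv C)) ->
  dependency c -> Q c.
Proof.
(* The induction runs on [d] with [c] fixed, so that all pieces are conformal to the original
   vector. *)
move=> Q0 QD Qc; suff H d : conformal c d -> dependency d -> Q d.
  by apply: H; apply: conformal_refl.
have [k] := ubnP #|supp d|; elim: k d => // k IH d /ltnSE dk cd dU.
have [->//|d0] := eqVneq d 0.
have [C [t [Cc e0 de]]] := conformal_circuit d0 dU; set e := t *: cv C in e0 de.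
have [i ei] := col_neq0 e0.
have sed : supp e \subset supp d.
  apply/fintype.subsetP => j; rewrite !inE; apply: contraNN => /eqP /(proj1 (de j)) ->.
  by [].
have hi : 0 < d i 0 * e i 0.
  rewrite lt_def (proj2 (de i)) andbT mulf_neq0 //.
  by apply: contraNneq ei => /(proj1 (de i)) ->.
have [r [r0 cf sp]] := conformal_reduce sed hi.
have -> : d = (d - r *: e) + r *: e by rewrite subrK.
apply: QD.
  apply: IH; first exact: leq_trans (proper_card sp) dk.
    exact: conformal_trans cf.
  rewrite /e scalerA; apply: dependencyB => //; exact: (cvP Cc).1.
rewrite /e scalerA; apply: Qc => //; rewrite -scalerA.
by apply: conformal_scale; [exact: ltW|exact: conformal_trans de].
Qed.

End Conformal.

(** * Transfer of sign vectors from one right-hand side to another *)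

Section SignVectors.
Context {R : realType} {m n : nat}.
Variables (U : 'M[R]_(m, n)) (cv : {set 'I_m} -> 'cV[R]_m).
Hypothesis cvP : forall C, circuit U C -> circuit_vector U C (cv C).

Lemma mulmx_dotv (x : 'cV[R]_n) i : (U *m x) i 0 = dotv (row i U)^T x.
Proof. by rewrite mxE; apply: eq_bigr => j _; rewrite !mxE. Qed.

Lemma dependency_dotv c (x : 'cV[R]_n) : dependency U c -> \sum_i c i 0 * (U *m x) i 0 = 0.
Proof.
move=> cU; transitivity (dotv (\sum_(i < m) c i 0 *: row i U)^T x); last first.
  by rewrite cU trmx0 dotv0l.
rewrite linear_sum dotv_suml; apply: eq_bigr => i _.
by rewrite linearZ /= dotvZl mulmx_dotv.
Qed.

Lemma sign_vector_transfer (a b : 'cV[R]_m) (x : 'cV[R]_n) :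
  (forall C, circuit U C -> Num.sg (dotv (cv C) a) = Num.sg (dotv (cv C) b)) ->
  exists y : 'cV[R]_n, forall i,
    Num.sg ((U *m y) i 0 - b i 0) = Num.sg ((U *m x) i 0 - a i 0).
Proof.
move=> sgab; pose z i := (U *m x) i 0 - a i 0; pose s i := Num.sg (z i).
(* Each row occurs twice. If [z i] is nonzero, both copies demand the strict sign [s i] of
   [(U *m y) i 0 - b i 0]; if [z i = 0], the copies are the two weak inequalities that force
   equality. *)
pose tau (ib : 'I_m * bool) := if z ib.1 != 0 then s ib.1 else (-1) ^+ ib.2.
pose v ib := tau ib *: (row ib.1 U)^T; pose beta ib := - (tau ib * b ib.1 0).
case: (fourier_motzkin v beta (fun ib => z ib.1 != 0)) => [[y hy]|[bb [g [der ng]]]].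
  exists y => i; have := hy (i, true); have := hy (i, false).
  rewrite /v /beta /tau /s /= !dotvZl -mulmx_dotv.
  rewrite -/(z i); case: (ltgtP (z i) 0) => zi /=.
  - by rewrite (ltr0_sg zi) => h _; rewrite ltr0_sg //; lra.
  - by rewrite (gtr0_sg zi) => h _; rewrite gtr0_sg //; lra.
  - rewrite expr0 expr1 zi sgr0 => h1 h2.
    by apply/eqP; rewrite sgr_eq0; apply/eqP/le_anti/andP; split; lra.
(* The multipliers of a derivation collect into one vector [c]; its sign is constrained only at rows
   with [z i] nonzero, and a strict conclusion must use such a row. *)
suff /(_ _ _ _ der)[c [cs cU cb cst]] : forall bb w g,
  derived v beta (fun ib => z ib.1 != 0) bb w g ->
  exists c : 'cV[R]_m, [/\ forall i, 0 <= s i * c i 0,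
    w = \sum_i c i 0 *: (row i U)^T, g = - dotv c b & bb -> exists i, 0 < s i * c i 0].
  have depc : dependency U c.
    apply: trmx_inj; rewrite trmx0 linear_sum [RHS]cU.
    by apply: eq_bigr => i _; rewrite linearZ.
  (* [Q c] contradicts the failed inequality, and [Q] passes to sums, so conformal circuit vectors
     suffice. *)
  pose Q (d : 'cV[R]_m) := dotv d b <= 0 /\ ((exists i, 0 < s i * d i 0) -> dotv d b < 0).
  suff [Qc1 Qc2] : Q c.
    case/negP: ng; rewrite cb; case: bb cst {der} => [/(_ isT)/Qc2|_] /=; last by lra.
    by rewrite oppr_gt0.
  apply: (conformal_ind cvP) depc.
  - split; rewrite ?dotv0l // => -[i].
    by rewrite mxE mulr0 ltxx.
  - move=> d e [d1 d2] [e1 e2]; rewrite /Q dotvDl; split; first by lra.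
    case=> i; rewrite mxE mulrDr => h.
    have [hd|hd] := ltP 0 (s i * d i 0).
      by have := d2 (ex_intro _ i hd); lra.
    have he : 0 < s i * e i 0 by lra.
    by have := e2 (ex_intro _ i he); lra.
  move=> C t Cc; set d := t *: cv C => cd.
  have sgd : Num.sg (dotv d a) = Num.sg (dotv d b).
    by rewrite /d !dotvZl !sgrM (sgab C Cc).
  have dU : dependency U d.
    have := dependencyB (U := U) (- t) (c := 0) (d := cv C) _ (cvP Cc).1.
    rewrite scaleNr opprK add0r; apply.
    by rewrite /dependency big1 // => i _; rewrite mxE scale0r.
  (* A dependency annihilates [U *m x], so pairing it with [a] is minus pairing it with [z]. The
     resulting sign is carried to [b] by [sgd]. *)
  have da : dotv d a = - \sum_i `|z i| * (s i * d i 0).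
    have -> : dotv d a = dotv d a - \sum_i d i 0 * (U *m x) i 0.
      by rewrite (dependency_dotv x dU) subr0.
    rewrite /dotv -sumrB -sumrN; apply: eq_bigr => i _.
    by rewrite mulrA -mulrA [`|_| * _]mulrA [`|_| * _]mulrC -numEsg /z; ring.
  have sd i : 0 <= s i * d i 0.
    have [d0 h] := cd i; case: (eqVneq (c i 0) 0) => [/d0 ->|ci]; first by rewrite mulr0.
    move: (cs i) h; rewrite /s; case: sgrP => zi; rewrite ?mul0r ?mul1r ?mulN1r // => csi h.
      have {}csi : 0 < c i 0 by rewrite lt_def ci.
      by rewrite pmulr_rge0 in h.
    have {}csi : c i 0 < 0 by rewrite lt_def eq_sym ci -oppr_ge0.
    by rewrite nmulr_rge0 // in h; rewrite oppr_ge0.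
  have da0 : dotv d a <= 0.
    by rewrite da oppr_le0 sumr_ge0 // => i _; rewrite mulr_ge0.
  rewrite /Q -sgr_le0 -sgr_lt0 -sgd sgr_le0 sgr_lt0; split=> // -[i hi].
  rewrite da oppr_lt0 (bigD1 i) //= ltr_pwDl ?sumr_ge0 // => [|j _]; last by rewrite mulr_ge0.
  rewrite mulr_gt0 // normr_gt0; apply: contraTneq hi => zi.
  by rewrite /s zi sgr0 mul0r ltxx.
move=> {}bb w {ng der}g; elim=> [[i e]||b1 w1 g1 b2 w2 g2 _ [c1 [s1 u1 -> t1]] _ [c2 [s2 u2 -> t2]]
  |r b1 w1 g1 r0 _ [c1 [s1 u1 -> t1]]].
- exists (tau (i, e) *: delta_mx i 0).
  have st : 0 <= s i * tau (i, e) /\ (z i != 0 -> 0 < s i * tau (i, e)).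
    rewrite /tau /s /=; case: sgrP => zi /=; rewrite ?mul0r ?eqxx //.
      by rewrite !mul1r.
    by rewrite mulrNN mul1r.
  split.
  + move=> j; rewrite !mxE eqxx andbT; case: eqVneq => [->|_]; rewrite ?mulr0 // mulr1.
    exact: st.1.
  + rewrite /v (bigD1 i) //= big1 ?addr0 => [|j ji]; rewrite !mxE eqxx ?eqxx /=.
      by rewrite mulr1.
    by rewrite (negbTE ji) mulr0 scale0r.
  + by rewrite /beta dotvZl dotvC dotv_delta.
  + by move=> /st.2 h; exists i; rewrite !mxE !eqxx mulr1.
- exists 0; split=> //.
  + by move=> i; rewrite mxE mulr0.
  + by rewrite big1 // => i _; rewrite mxE scale0r.
  + by rewrite dotv0l oppr0.
- exists (c1 + c2); split.
  + by move=> i; rewrite mxE mulrDr addr_ge0.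
  + by rewrite u1 u2 -big_split; apply: eq_bigr => i _; rewrite mxE scalerDl.
  + by rewrite dotvDl opprD.
  + by case/orP => [/t1|/t2] [i hi]; exists i; rewrite mxE mulrDr;
      [apply: ltr_pwDl|apply: ltr_wpDl].
- exists (r *: c1); split.
  + by move=> i; rewrite mxE mulrCA mulr_ge0 // ltW.
  + by rewrite u1 scaler_sumr; apply: eq_bigr => i _; rewrite mxE scalerA.
  + by rewrite dotvZl mulrN.
  + by move=> /t1 [i hi]; exists i; rewrite mxE mulrCA mulr_gt0.
Qed.

End SignVectors.

(** Gives a step size that respects finitely many positive slacks [g] under rates of change [h]. The
    denominators [g i + |h i|] stay positive even where [h i = 0]. *)
Lemma exists_small (R : realType) (T : finType) (g h : T -> R) :
  (forall i, 0 < g i) -> exists e : R, 0 < e /\ forall i, e * h i < g i.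
Proof.
move=> g0.
have den i : 0 < g i + `|h i| by rewrite ltr_pwDl.
suff [e [e0 he]] : exists e : R, 0 < e /\ forall i, e <= g i / (g i + `|h i|).
  exists (e / 2); split=> [|i]; first by rewrite divr_gt0.
  have := he i; rewrite ler_pdivlMr // => hi.
  have : e * h i <= e * `|h i| by rewrite ler_pM2l // ler_norm.
  have : 0 < e * g i by rewrite mulr_gt0.
  by have := g0 i; nra.
have [i _|no] := pickP (@predT T); last by exists 1; split=> // i; have := no i.
pose f i := g i / (g i + `|h i|).
case: (Order.TotalTheory.arg_minP (P := predT) f (i0 := i)) => // j _ hj.
by exists (f j); split=> [|k]; [rewrite divr_gt0|apply: hj].
Qed.

(** * Feasible directions and normal cones *)

Section Polyhedra.
Context {R : realType} {m n : nat}.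
Variables (U : 'M[R]_(m, n)) (I J K : {set 'I_m}).
Hypothesis IJK : partition3 I J K.
Implicit Types (a b : 'cV[R]_m) (x y z d : 'cV[R]_n) (G : set 'cV[R]_n).

Definition rowval x i : R := (U *m x) i 0.

Definition active a x i : Prop := rowval x i = a i 0.

Definition tangent a x d : Prop := forall i,
  (i \in I -> rowval d i = 0) /\
  (i \in J -> active a x i -> rowval d i <= 0) /\
  (i \in K -> active a x i -> 0 <= rowval d i).

Lemma valD x y i : rowval (x + y) i = rowval x i + rowval y i.
Proof. by rewrite /rowval mulmxDr mxE. Qed.

Lemma valZ (t : R) x i : rowval (t *: x) i = t * rowval x i.
Proof. by rewrite /rowval -scalemxAr mxE. Qed.

Lemma valB x y i : rowval (x - y) i = rowval x i - rowval y i.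
Proof. by rewrite valD -scaleN1r valZ mulN1r. Qed.

Lemma tangent_sub a x y : Pol U a I J K x -> Pol U a I J K y -> tangent a x (y - x).
Proof.
move=> Px Py i; have [xI [xJ xK]] := Px i; have [yI [yJ yK]] := Py i.
rewrite valB /active /rowval; split; first by move=> iI; rewrite xI // yI // subrr.
by split=> iJ ->; rewrite ?subr_le0 ?subr_ge0; auto.
Qed.

(** Active constraints are preserved along [d] by tangency, inactive ones by taking the step shorter
    than their slack allows. *)
Lemma tangent_Pol a x d : Pol U a I J K x -> tangent a x d ->
  exists e : R, 0 < e /\ Pol U a I J K (x + e *: d).
Proof.
move=> Px td.
(* The value 1 at active rows is a placeholder that keeps [g] positive. *)
pose g i := if rowval x i == a i 0 then 1 else `|rowval x i - a i 0|.
have g0 i : 0 < g i.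
  by rewrite /g; case: eqVneq => // ne; rewrite normr_gt0 subr_eq0.
have [e [e0 he]] := exists_small (fun i => `|rowval d i|) g0.
exists e; split=> // i; have [xI [xJ xK]] := Px i; have [dI [dJ dK]] := td i.
rewrite -/(rowval _ i) valD valZ; rewrite -!/(rowval x i) in xI xJ xK.
have := he i; rewrite /g; case: eqVneq => [ai _|ai hi].
  rewrite ai; split=> [/dI ->|]; first by rewrite mulr0 addr0.
  split=> h; first by rewrite gerDl pmulr_rle0 //; apply: dJ.
  by rewrite lerDl pmulr_rge0 //; apply: dK.
have {}hi : `|e * rowval d i| < `|rowval x i - a i 0| by rewrite normrM (gtr0_norm e0).
split=> [iI|]; first by rewrite xI ?eqxx in ai.
split=> [/xJ|/xK] h.
  have hlt : rowval x i < a i 0 by rewrite lt_neqAle ai.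
  by move: hi; rewrite (ltr0_norm (x := rowval x i - _)) ?subr_lt0 // ltr_norml; lra.
have hlt : a i 0 < rowval x i by rewrite lt_neqAle eq_sym ai.
by move: hi; rewrite (gtr0_norm (x := rowval x i - _)) ?subr_gt0 // ltr_norml; lra.
Qed.

Lemma normal_cone_tangent a x u : Pol U a I J K x ->
  (normal_cone (Pol U a I J K) x u <-> forall d, tangent a x d -> dotv u d <= 0).
Proof.
move=> Px; split=> [nu d /(tangent_Pol Px)[e [e0 /nu]]|h y Py].
  by rewrite dotvDr dotvZr gerDl pmulr_rle0.
by have := h _ (tangent_sub Px Py); rewrite dotvBr subr_le0.
Qed.

Lemma normal_cone_active a b x y : Pol U a I J K x -> Pol U b I J K y ->
  (forall i, active a x i <-> active b y i) ->
  normal_cone (Pol U a I J K) x = normal_cone (Pol U b I J K) y.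
Proof.
move=> Px Py xy; apply/seteqP; split=> u /= /normal_cone_tangent h;
  apply/normal_cone_tangent => // d td; apply: h => // i; have [dI [dJ dK]] := td i;
  by split=> //; split=> iX /xy; [apply: dJ|apply: dK].
Qed.

(** * Faces and active constraints *)

Lemma poly_face_sub (P G : set 'cV[R]_n) : poly_face P G -> G `<=` P.
Proof. by move=> [u [h [_ ->]]] x []. Qed.

Lemma poly_face_set0 (P : set 'cV[R]_n) : poly_face P set0.
Proof.
exists 0, 1; split=> [y _|]; first by rewrite dotv0l.
by apply/seteqP; split=> // x [_]; rewrite dotv0l => /eqP; rewrite eq_sym oner_eq0.
Qed.

(** Since constraints active at [x] stay active at [y], the segment from [y] to [x] extends slightly
    beyond [x] inside the polyhedron. A functional maximal at [x] is then maximal at [y] too. *)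
Lemma poly_face_up a G x y : poly_face (Pol U a I J K) G -> G x ->
  Pol U a I J K y -> (forall i, active a x i -> active a y i) -> G y.
Proof.
move=> [u [h [hu ->]]] [Px ux] Py xy; split=> //.
have tdy : tangent a x (x - y).
  move=> i; have [xI [xJ xK]] := Px i; have [yI [yJ yK]] := Py i.
  rewrite valB /rowval; split=> [iI|]; first by rewrite xI // yI // subrr.
  by split=> iX ai; rewrite -!/(rowval _ i) ai (xy _ ai) subrr.
have [e [e0 /hu]] := tangent_Pol Px tdy.
rewrite dotvDr dotvZr dotvBr ux gerDl pmulr_rle0 // subr_le0 => hy.
by apply/le_anti; rewrite hy hu.
Qed.

(** An average of two slacks of the same sign vanishes only if both do. *)
Lemma midpoint_active a x y i : Pol U a I J K x -> Pol U a I J K y ->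
  active a (2^-1 *: x + 2^-1 *: y) i -> active a x i /\ active a y i.
Proof.
move=> Px Py; have [xI [xJ xK]] := Px i; have [yI [yJ yK]] := Py i.
rewrite /active valD !valZ; rewrite -!/(rowval _ i) in xI xJ xK yI yJ yK.
have [/or3P[iX|iX|iX] _] := IJK i; first by rewrite xI // yI.
  by have := xJ iX; have := yJ iX; lra.
by have := xK iX; have := yK iX; lra.
Qed.

Lemma poly_face_midpoint (P G : set 'cV[R]_n) x y :
  P (2^-1 *: x + 2^-1 *: y) ->
  poly_face P G -> G x -> G y -> G (2^-1 *: x + 2^-1 *: y).
Proof.
move=> Pm [u [h [_ ->]]] [_ ux] [_ uy]; split=> //.
by rewrite dotvDr !dotvZr ux uy; field.
Qed.

Lemma Pol_midpoint a x y : Pol U a I J K x -> Pol U a I J K y ->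
  Pol U a I J K (2^-1 *: x + 2^-1 *: y).
Proof.
move=> Px Py i; have [xI [xJ xK]] := Px i; have [yI [yJ yK]] := Py i.
rewrite -/(rowval _ i) valD !valZ; rewrite -!/(rowval _ i) in xI xJ xK yI yJ yK.
split; first by move=> iX; rewrite xI // yI //; field.
by split=> iX; [have := xJ iX; have := yJ iX|have := xK iX; have := yK iX]; lra.
Qed.

(** If some [y] in [G] loses a constraint active at [x], the midpoint of [x] and [y] has strictly
    fewer active constraints than [x]; this descent stops. *)
Lemma poly_face_generic a G : poly_face (Pol U a I J K) G -> (exists x, G x) ->
  exists x, G x /\ forall y, G y -> forall i, active a x i -> active a y i.
Proof.
move=> fG [x0 Gx0].
pose act x : {set 'I_m} := [set i | `[< active a x i >]]%SET.
have [k] := ubnP #|act x0|; elim: k x0 Gx0 => // k IH x Gx /ltnSE xk.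
have [hx|] := pselect (forall y, G y -> forall i, active a x i -> active a y i).
  by exists x.
move=> /existsNP[y /not_implyP[Gy /existsNP[i /not_implyP[xi nyi]]]].
have [Px Py] := (poly_face_sub fG Gx, poly_face_sub fG Gy).
apply: (IH (2^-1 *: x + 2^-1 *: y)).
  exact: poly_face_midpoint (Pol_midpoint Px Py) fG Gx Gy.
apply: leq_trans xk; apply: proper_card; apply/properP; split.
  by apply/fintype.subsetP => j; rewrite !inE => h;
    case: (midpoint_active Px Py h).
exists i; first by rewrite !inE.
by apply/negP; rewrite !inE => h; case: (midpoint_active Px Py h).
Qed.

Lemma val_bound d i (e : R) : (forall j, `|d j 0| < e) -> 0 < e ->
  `|rowval d i| <= e * \sum_j `|U i j|.
Proof.
move=> hd e0; rewrite /rowval mxE mulr_sumr; apply: le_trans (ler_norm_sum _ _ _) _.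
apply: ler_sum => j _; rewrite normrM mulrC ler_wpM2r //; exact: ltW.
Qed.

(** Constraints active at [x] are equalities on [G], hence on its affine hull, and so is the
    equation exposing [G]. Inactive constraints survive a small perturbation. *)
Lemma generic_relint a G x : poly_face (Pol U a I J K) G -> G x ->
  (forall y, G y -> forall i, active a x i -> active a y i) -> relint G x.
Proof.
move=> fG Gx hx; split=> //; have Px := poly_face_sub fG Gx.
pose g i := if rowval x i == a i 0 then 1 else `|rowval x i - a i 0|.
have g0 i : 0 < g i.
  by rewrite /g; case: eqVneq => // ne; rewrite normr_gt0 subr_eq0.
have [e [e0 he]] := exists_small (fun i => \sum_j `|U i j|) g0.
exists e; split=> // y [k [p [w [Gp [w1 yE]]]]] hy.
have valy i : rowval y i = \sum_l w l * rowval (p l) i.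
  rewrite yE /rowval mulmx_sumr summxE; apply: eq_bigr => l _.
  by rewrite -scalemxAr mxE.
have acty i : active a x i -> active a y i.
  move=> xi; rewrite /active valy.
  under eq_bigr => l _ do rewrite (hx _ (Gp l) i xi).
  by rewrite -mulr_suml w1 mul1r.
have Py : Pol U a I J K y.
  move=> i; have [xI [xJ xK]] := Px i; rewrite -!/(rowval _ i) in xI xJ xK *.
  have := he i; rewrite /g; case: eqVneq => [xi _|xi hi].
    by rewrite (acty i xi).
  have {}hi : `|rowval y i - rowval x i| < `|rowval x i - a i 0|.
    apply: le_lt_trans hi; rewrite -valB; apply: val_bound => // j.
    by rewrite !mxE.
  split=> [iI|]; first by rewrite xI ?eqxx in xi.
  split=> [/xJ|/xK] h; move: hi.
    have hlt : rowval x i < a i 0 by rewrite lt_neqAle xi.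
    by rewrite (ltr0_norm (x := rowval x i - _)) ?subr_lt0 // ltr_norml; lra.
  have hlt : a i 0 < rowval x i by rewrite lt_neqAle eq_sym xi.
  by rewrite (gtr0_norm (x := rowval x i - _)) ?subr_gt0 // ltr_norml; lra.
case: (fG) => u [h [hu GE]]; rewrite GE; split=> //.
rewrite yE dotvC dotv_suml -[RHS]mul1r -w1 mulr_suml; apply: eq_bigr => l _.
by have := Gp l; rewrite GE => -[_ <-]; rewrite dotvZl dotvC.
Qed.

(** For [x] in the polyhedron this is the smallest face through [x]: [poly_face_up] puts it inside
    every other one. *)
Definition active_face a x : set 'cV[R]_n :=
  [set y | Pol U a I J K y /\ forall i, active a x i -> active a y i].

(** The exposing functional is the sum of the outer normals of the inequalities active at [x]. Each
    summand is maximal at [x], so equality of the sums forces equality in every term. *)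
Lemma active_face_poly a x : Pol U a I J K x -> poly_face (Pol U a I J K) (active_face a x).
Proof.
move=> Px.
pose sgn i : R := if rowval x i != a i 0 then 0 else
  if i \in J then 1 else if i \in K then -1 else 0.
pose u := \sum_i sgn i *: (row i U)^T.
have uE y : dotv u y = \sum_i sgn i * rowval y i.
  rewrite dotv_suml; apply: eq_bigr => i _; rewrite dotvZl; congr (_ * _).
  by rewrite /rowval mxE; apply: eq_bigr => j _; rewrite !mxE.
have term y i : Pol U a I J K y -> 0 <= sgn i * (rowval x i - rowval y i).
  move=> Py; rewrite /sgn; case: eqVneq => [xi|_] /=; last by rewrite mul0r.
  have [_ [yJ yK]] := Py i; rewrite -!/(rowval _ i) in yJ yK; rewrite xi.
  case: ifP => [/yJ|_]; first by rewrite mul1r subr_ge0.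
  case: ifP => [/yK|_]; last by rewrite mul0r.
  by rewrite mulN1r oppr_ge0 subr_le0.
have diff y : dotv u x - dotv u y = \sum_i sgn i * (rowval x i - rowval y i).
  by rewrite !uE -sumrB; apply: eq_bigr => i _; rewrite mulrBr.
exists u, (dotv u x); split=> [y Py|].
  by rewrite -subr_ge0 diff sumr_ge0 // => i _; apply: term.
apply/seteqP; split=> y /= [Py hy]; split=> //.
  apply/eqP; rewrite eq_sym -subr_eq0 diff big1 // => i _; rewrite /sgn.
  by case: eqVneq => [xi|_] /=; rewrite ?mul0r // xi (hy i xi) subrr mulr0.
move=> i xi; have [yI _] := Py i.
have /eqP : dotv u x - dotv u y = 0 by rewrite hy subrr.
rewrite diff psumr_eq0 => [/allP/(_ i)|j _]; last exact: term.
rewrite mem_index_enum => /(_ isT) /=; rewrite /sgn xi eqxx /= /active.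
have [/or3P[iX|iX|iX] [/negP h1 [/negP h2 /negP h3]]] := IJK i.
- by move=> _; apply: yI.
- by rewrite iX mul1r subr_eq0 => /eqP.
- case: ifP => [_|_]; first by rewrite mul1r subr_eq0 => /eqP.
  by rewrite iX mulN1r oppr_eq0 subr_eq0 => /eqP.
Qed.

(** * The normal fan in terms of points *)

Lemma relint_extend G x y : relint G x -> G y -> exists e : R, 0 < e /\ G (x + e *: (x - y)).
Proof.
move=> [Gx [e [e0 he]]] Gy.
have [t [t0 ht]] := exists_small (fun j : 'I_n => `|x j 0 - y j 0|) (fun _ => e0).
exists t; split=> //; apply: he => [|j]; last first.
  by rewrite !mxE addrAC subrr add0r normrM (gtr0_norm t0).
(* The point is the affine combination [(1 + t) x - t y]. *)
exists 2%N, (fun l => if l == 0 then x else y), (fun l => if l == 0 then 1 + t else - t).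
split; first by move=> l; case: ifP.
rewrite !big_ord_recl !big_ord0 /=; split; first by ring.
by apply/colP => j; rewrite !mxE; ring.
Qed.

(** If [u] is maximal at [y] in the relative interior, extending the segment from [x] beyond [y]
    shows that [u] is no smaller at [x] than at [y]. *)
Lemma normal_cone_face_relint (P G : set 'cV[R]_n) x : G `<=` P -> relint G x ->
  normal_cone_face P G = normal_cone P x.
Proof.
move=> GP rx; apply/seteqP; split=> [u [y [ry nu]]|u nu]; last by exists x.
move=> z Pz; apply: le_trans (nu z Pz) _.
have [e [e0 /GP/nu]] := relint_extend ry rx.1.
by rewrite dotvDr dotvZr gerDl pmulr_rle0 // dotvBr subr_le0.
Qed.

(** A nonempty face has a generic point, which lies in its relative interior; conversely, [x] is
    generic in [active_face a x]. *)
Lemma normal_fanE a :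
  normal_fan (Pol U a I J K) =
  [set N | exists x, Pol U a I J K x /\ N = normal_cone (Pol U a I J K) x].
Proof.
apply/seteqP; split=> N.
  move=> [G [fG [neG ->]]]; have [x [Gx hx]] := poly_face_generic fG neG.
  exists x; split; first exact: poly_face_sub fG _ Gx.
  apply: normal_cone_face_relint; first exact: poly_face_sub fG.
  exact: generic_relint fG Gx hx.
move=> [x [Px ->]]; have fx := active_face_poly Px.
exists (active_face a x); split=> //; split; first by exists x.
apply/esym/normal_cone_face_relint; first by move=> y [].
by apply: generic_relint fx _ _ => // y [].
Qed.

(** * The isomorphism of face posets *)

(** Phrased through all points of [G] rather than a chosen generic one, so that monotonicity is
    immediate. *)
Definition face_map a b G : set 'cV[R]_n :=
  [set y | Pol U b I J K y /\
           exists g, G g /\ forall i, active a g i -> active b y i].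

Lemma face_mapS a b G1 G2 : G1 `<=` G2 -> face_map a b G1 `<=` face_map a b G2.
Proof. by move=> G12 y [Py [g [/G12 Gg gy]]]; split=> //; exists g. Qed.

Definition active_match a b : Prop :=
  forall x, Pol U a I J K x ->
    exists y, Pol U b I J K y /\ forall i, active a x i <-> active b y i.

(** The image is [active_face b y], where [y] matches a generic point of [G]. *)
Lemma face_map_poly a b G : active_match a b ->
  poly_face (Pol U a I J K) G -> poly_face (Pol U b I J K) (face_map a b G).
Proof.
move=> ab fG; have [neG|eG] := pselect (exists x, G x); last first.
  have -> : face_map a b G = set0; last exact: poly_face_set0.
  by apply/seteqP; split=> // y [_ [g [Gg _]]]; apply: eG; exists g.
have [x [Gx hx]] := poly_face_generic fG neG.
have [y [Py xy]] := ab x (poly_face_sub fG Gx).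
have -> : face_map a b G = active_face b y; last exact: active_face_poly.
apply/seteqP; split=> z [Pz].
  by move=> [g [Gg gz]]; split=> // i /xy xi; apply: gz; apply: hx.
by move=> yz; split=> //; exists x; split=> // i /xy; apply: yz.
Qed.

(** A round trip only enlarges active sets, so [poly_face_up] leads back into [G]; a matching point
    provides the other inclusion. *)
Lemma face_mapK a b G : active_match a b ->
  poly_face (Pol U a I J K) G -> face_map b a (face_map a b G) = G.
Proof.
move=> ab fG; apply/seteqP; split=> [z [Pz [y [[Py [g [Gg gy]]] yz]]]|z Gz].
  by apply: (poly_face_up fG Gg Pz) => i /gy; apply: yz.
have Pz := poly_face_sub fG Gz; split=> //; have [y [Py zy]] := ab z Pz.
by exists y; split=> [|i /zy //]; split=> //; exists z; split=> // i /zy.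
Qed.

Lemma match_normally_equivalent a b : active_match a b -> active_match b a ->
  normally_equivalent (Pol U a I J K) (Pol U b I J K).
Proof.
move=> ab ba; rewrite /normally_equivalent !normal_fanE.
apply/seteqP; split=> N [x [Px ->]].
  have [y [Py xy]] := ab x Px; exists y; split=> //; exact: normal_cone_active.
have [y [Py xy]] := ba x Px; exists y; split=> //; exact: normal_cone_active.
Qed.

Lemma match_combinatorially_equivalent a b : active_match a b -> active_match b a ->
  combinatorially_equivalent (Pol U a I J K) (Pol U b I J K).
Proof.
move=> ab ba; exists (face_map a b); split; first by move=> G; apply: face_map_poly.
split; first by move=> G1 G2 f1 f2 e; rewrite -(face_mapK ab f1) e face_mapK.
split=> [H fH|G1 G2 f1 f2].
  by exists (face_map b a H); split; [apply: face_map_poly|apply: face_mapK].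
split; first exact: face_mapS.
by move=> /(@face_mapS b a); rewrite !face_mapK.
Qed.

End Polyhedra.

(** * From signs on circuits to equivalence of polyhedra *)

Lemma active_match_sign (R : realType) (m n : nat) (U : 'M[R]_(m, n)) (I J K : {set 'I_m})
    (cv : {set 'I_m} -> 'cV[R]_m) (a b : 'cV[R]_m) :
  (forall C, circuit U C -> circuit_vector U C (cv C)) ->
  (forall C, circuit U C -> Num.sg (dotv (cv C) a) = Num.sg (dotv (cv C) b)) ->
  active_match U I J K a b.
Proof.
move=> cvP sgab x Px; have [y hy] := sign_vector_transfer cvP x sgab.
exists y; split=> i; last first.
  rewrite /active /rowval; split=> /eqP; rewrite -subr_eq0 -sgr_eq0.
    by rewrite -hy sgr_eq0 subr_eq0 => /eqP.
  by rewrite hy sgr_eq0 subr_eq0 => /eqP.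
have [xI [xJ xK]] := Px i; split.
  move=> /xI/eqP; rewrite -subr_eq0 -sgr_eq0 -hy sgr_eq0 subr_eq0 => /eqP //.
split; first by move=> /xJ; rewrite -subr_le0 -sgr_le0 -hy sgr_le0 subr_le0.
by move=> /xK; rewrite -subr_ge0 -sgr_ge0 -hy sgr_ge0 subr_ge0.
Qed.

Theorem theorem1p1 (R : realType) (m n : nat) (U : 'M[R]_(m, n))
  (cv : {set 'I_m} -> 'cV[R]_m) :
  (forall i : 'I_m, row i U != 0) ->
  (forall C, circuit U C -> circuit_vector U C (cv C)) ->
  forall Fo : set 'cV[R]_m, derived_open_face U cv Fo ->
  forall a b : 'cV[R]_m, Fo a -> Fo b ->
  forall I J K : {set 'I_m}, partition3 I J K ->
    ((Pol U a I J K = set0) <-> (Pol U b I J K = set0)) /\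
    ((exists x, Pol U a I J K x) ->
       normally_equivalent (Pol U a I J K) (Pol U b I J K) /\
       combinatorially_equivalent (Pol U a I J K) (Pol U b I J K)).
Proof.
move=> _ cvP Fo [_ [eps [_ ->]]] a b Fa Fb I J K IJK.
have ab : active_match U I J K a b.
  by apply: active_match_sign cvP _ => C Cc; rewrite Fa // Fb.
have ba : active_match U I J K b a.
  by apply: active_match_sign cvP _ => C Cc; rewrite Fa // Fb.
split; last first.
  move=> _; split; first exact: match_normally_equivalent.
  exact: match_combinatorially_equivalent.
(* A point of one polyhedron would be matched with a point of the empty one. *)
by split=> e; apply/seteqP; split=> // x;
  [move=> /ba|move=> /ab]; rewrite e => -[y []].
Qed.
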